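(* Fix an affine referential $(R_0,\dots,R_n)$ on the real finite-dimensional affine space $A$. A metric $m\in\mathrm{Met}(A)$ with hessian principal component $g$ is non-degenerate if and only if the following hollow symmetric $(n+2)\times(n+2)$ matrix is non-degenerate: $$\begin{bmatrix}D&\mathbf 1^t\\ \mathbf 1&0\end{bmatrix},\qquad D_{ij}=g(\overrightarrow{R_iR_j},\overrightarrow{R_iR_j})\quad(0\le i,j\le n),$$ where $\mathbf 1=[1\,\dots\,1]$ has $n+1$ entries.
   Context: All spaces are real and finite-dimensional. $A$ has director vector space $\vec A$ and dimension $n$; an affine referential is a sequence of $n+1$ affinely independent points. $\mathrm{Aff}(A)$ is the vector space of affine functions $A\to\mathbb R$. A function $\delta:A\to\mathbb R$ is quadratic if $\delta(\alpha P+\beta Q)=\alpha(\alpha-\beta)\delta(P)+\beta(\beta-\alpha)\delta(Q)+4\alpha\beta\,\delta(\frac{P+Q}2)$ for all $P,Q\in A$ and $\alpha+\beta=1$; $\mathrm{Quad}(A)$ is the vector space of these. Each $\delta\in\mathrm{Quad}(A)$ has a symmetric bilinear form $\mathrm{Hess}\,\delta$ on $\vec A$ (hessian principal component), characterized by $\frac12(\delta(Q)+\delta(2P-Q))-\delta(P)=\frac12\mathrm{Hess}\,\delta(\overrightarrow{PQ},\overrightarrow{PQ})$ for all $P,Q\in A$. $\mathrm{Met}(A)=\mathrm{Quad}(A)/\mathrm{Aff}(A)$ is the space of metrics; all representatives of $m\in\mathrm{Met}(A)$ share the same hessian principal component $g$ (that of $m$). The radical of $m$ is the nullspace of $g$;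 $m$ is non-degenerate if its radical is trivial. A symmetric matrix is hollow if its diagonal vanishes. *)

(* Defs.v *)
From HB Require Import structures.
From mathcomp Require Import all_boot all_order all_algebra.
From mathcomp Require Import generic_quotient ring_quotient sesquilinear.
From mathcomp Require Import boolp functions reals.
From mathcomp Require Import ring lra.

Set Implicit Arguments.
Unset Strict Implicit.
Unset Printing Implicit Defensive.

Import Order.TTheory GRing.Theory Num.Theory.
Import Quotient.Exports.

Local Open Scope ring_scope.
Local Open Scope quotient_scope.

HB.mixin Record isAffineSpace (R : realType) (V : vectType R) (A : Type) := {
  translate : A -> V -> A;
  vec : A -> A -> V;
  affine_inhabited : inhabited A;
  translateD : forall P u v, translate (translate P u) v = translate P (u + v);
  translate_vec : forall P Q, translate P (vec P Q) = Q;
  vec_translate : forall P u, vec P (translate P u) = u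
}.

#[short(type="affineType")]
HB.structure Definition AffineSpace (R : realType) (V : vectType R) :=
  {A of isAffineSpace R V A}.

Section Affine.
Variables (R : realType) (V : vectType R) (A : affineType V).
Implicit Types (P Q : A) (u v w : V) (a b : R).

Definition affine_dim : nat := \dim {:V}.

(* The affine combination (1 - b) P + b Q. *)
Definition acomb P Q b : A := translate P (b *: vec P Q).

Definition midpoint P Q : A := acomb P Q 2^-1.

(* 2P - Q, the reflection of Q through P. *)
Definition reflection P Q : A := acomb P Q (- 1).

Definition affinely_independent n (r : 'I_n.+1 -> A) : Prop :=
  free [seq vec (r ord0) (r (lift ord0 i)) | i : 'I_n].

Definition affine_referential n (r : 'I_n.+1 -> A) : Prop :=
  n = affine_dim /\ affinely_independent r.

(* R^o is R as a vector space over itself, so that A -> R^o is one too. *)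
Definition is_affine (d : A -> R^o) : Prop :=
  forall P Q a b, a + b = 1 -> d (acomb P Q b) = a * d P + b * d Q.

Definition is_quadratic (d : A -> R^o) : Prop :=
  forall P Q a b, a + b = 1 ->
    d (acomb P Q b) =
      a * (a - b) * d P + b * (b - a) * d Q + 4 * a * b * d (midpoint P Q).

Definition is_hessian (d : A -> R^o) (g : {symmetric V}) : Prop :=
  forall P Q, 2^-1 * (d Q + d (reflection P Q)) - d P
              = 2^-1 * g (vec P Q) (vec P Q).

Lemma translate0 P : translate P 0 = P.
Proof.
by rewrite -{1}(translate_vec P P) translateD addr0 translate_vec.
Qed.

Lemma acomb_translate P u b : acomb P (translate P u) b = translate P (b *: u).
Proof. by rewrite /acomb vec_translate. Qed.

Lemma is_affine_quadratic d : is_affine d -> is_quadratic d.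
Proof.
move=> dA P Q a b ab; rewrite (dA _ _ a b ab) /midpoint.
rewrite (dA P Q 2^-1 2^-1); last by field.
have -> : a = 1 - b by rewrite -ab addrK.
by field.
Qed.

Definition quadratic : {pred A -> R^o} := fun d => `[< is_quadratic d >].

Lemma quadratic_submod : submod_closed quadratic.
Proof.
split=> [|c d e /asboolP dq /asboolP eq]; apply/asboolP=> P Q a b ab.
  by rewrite /= !mulr0 !addr0.
rewrite !fctE /= (dq _ _ _ _ ab) (eq _ _ _ _ ab) /GRing.scale /=; ring.
Qed.

HB.instance Definition _ :=
  GRing.isSubmodClosed.Build R (A -> R^o) quadratic quadratic_submod.

Record Quad := MkQuad { quad_fun :> A -> R^o; _ : quad_fun \in quadratic }.

HB.instance Definition _ := [isSub for quad_fun].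
HB.instance Definition _ := [Choice of Quad by <:].
HB.instance Definition _ := [SubChoice_isSubLmodule of Quad by <:].

(* Affine functions, as a subspace of Quad: no affine function is lost, by
   is_affine_quadratic. *)
Definition Aff : {pred Quad} := fun d => `[< is_affine d >].

Lemma Aff_submod : submod_closed Aff.
Proof.
split=> [|c d e /asboolP dq /asboolP eq]; apply/asboolP=> P Q a b ab.
  by rewrite /= !mulr0 addr0.
rewrite /= !fctE /= (dq _ _ _ _ ab) (eq _ _ _ _ ab) /GRing.scale /=; ring.
Qed.

HB.instance Definition _ := GRing.isSubmodClosed.Build R Quad Aff Aff_submod.

Definition Met : Type := Quotient.quot Aff.

HB.instance Definition _ := GRing.Zmodule.on Met.

Definition met_scale a (m : Met) : Met := \pi_Met (a *: repr m).

Lemma met_scale_pi a (d : Quad) : met_scale a (\pi_Met d) = \pi_Met (a *: d).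
Proof.
apply/eqP; rewrite -Quotient.idealrBE -scalerBr rpredZ //.
by rewrite Quotient.idealrBE reprK.
Qed.

Lemma met_scaleA a b m : met_scale a (met_scale b m) = met_scale (a * b) m.
Proof.
by rewrite -[m]reprK [met_scale b _]met_scale_pi !met_scale_pi scalerA.
Qed.

Lemma met_scale1 : left_id 1 met_scale.
Proof. by move=> m; rewrite -[m]reprK met_scale_pi scale1r. Qed.

Lemma met_scaleDr : right_distributive met_scale +%R.
Proof.
by move=> a m k; rewrite -[m]reprK -[k]reprK -raddfD !met_scale_pi scalerDr raddfD.
Qed.

Lemma met_scaleDl m : {morph met_scale^~ m : a b / a + b}.
Proof. by move=> a b; rewrite -[m]reprK !met_scale_pi scalerDl raddfD. Qed.

HB.instance Definition _ := GRing.Zmodule_isLmodule.Build R Met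
  met_scaleA met_scale1 met_scaleDr met_scaleDl.

Section HessianExistence.
Variable (d : A -> R^o).
Hypothesis dq : is_quadratic d.
Variable O : A.

Let f u : R := d (translate O u).

Let f_line u w b :
  f (u + b *: w) = (1 - b) * (1 - 2 * b) * f u + b * (2 * b - 1) * f (u + w)
                   + 4 * (1 - b) * b * f (u + 2^-1 *: w).
Proof.
have := dq (translate O u) (translate (translate O u) w) (subrK b 1).
rewrite /midpoint !acomb_translate !translateD /f => ->; ring.
Qed.

Let f_cubic u w :
  f (u + 3 *: w) = f u - 3 * f (u + w) + 3 * f (u + 2 *: w).
Proof.
have := f_line u (2 *: w) (3 / 2).
have -> : (3 / 2) *: (2 *: w) = 3 *: w by rewrite scalerA divfK ?pnatr_eq0.
have -> : 2^-1 *: (2 *: w) = w by rewrite scalerA mulVf ?scale1r ?pnatr_eq0.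
move=> ->; by field.
Qed.

(* The second difference of a quadratic function is translation invariant. *)
Let f_second_diff u w : f (u + w) + f (u - w) - 2 * f u = f w + f (- w) - 2 * f 0.
Proof.
pose F (x y : int) := f (x%:~R *: u + y%:~R *: w).
have FE (x y a b : int) : F (x + a * 3) (y + b * 3) =
    F x y - 3 * F (x + a) (y + b) + 3 * F (x + a * 2) (y + b * 2).
  have := f_cubic (x%:~R *: u + y%:~R *: w) (a%:~R *: u + b%:~R *: w).
  rewrite /F !scalerDr !scalerA ![_ + _ *: w + (_ + _)]addrACA -!scalerDl.
  by rewrite -[3 * a%:~R]mulrC -[3 * b%:~R]mulrC -[2 * a%:~R]mulrC
    -[2 * b%:~R]mulrC !intrD !intrM.
have r0 : F 2 (-1) = F (-1) (-1) - 3 * F 0 (-1) + 3 * F 1 (-1) by exact: (FE (-1) (-1) 1 0).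
have r1 : F 2 0 = F (-1) 0 - 3 * F 0 0 + 3 * F 1 0 by exact: (FE (-1) 0 1 0).
have r2 : F 2 1 = F (-1) 1 - 3 * F 0 1 + 3 * F 1 1 by exact: (FE (-1) 1 1 0).
have r3 : F 2 2 = F (-1) 2 - 3 * F 0 2 + 3 * F 1 2 by exact: (FE (-1) 2 1 0).
have r4 : F 2 (-2) = F (-1) (-2) - 3 * F 0 (-2) + 3 * F 1 (-2) by exact: (FE (-1) (-2) 1 0).
have c0 : F (-1) 2 = F (-1) (-1) - 3 * F (-1) 0 + 3 * F (-1) 1 by exact: (FE (-1) (-1) 0 1).
have c1 : F 0 2 = F 0 (-1) - 3 * F 0 0 + 3 * F 0 1 by exact: (FE 0 (-1) 0 1).
have c2 : F 1 2 = F 1 (-1) - 3 * F 1 0 + 3 * F 1 1 by exact: (FE 1 (-1) 0 1).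
have e0 : F (-1) 1 = F (-1) (-2) - 3 * F (-1) (-1) + 3 * F (-1) 0 by exact: (FE (-1) (-2) 0 1).
have e1 : F 0 1 = F 0 (-2) - 3 * F 0 (-1) + 3 * F 0 0 by exact: (FE 0 (-2) 0 1).
have e2 : F 1 1 = F 1 (-2) - 3 * F 1 (-1) + 3 * F 1 0 by exact: (FE 1 (-2) 0 1).
have d0 : F 2 2 = F (-1) (-1) - 3 * F 0 0 + 3 * F 1 1 by exact: (FE (-1) (-1) 1 1).
have d1 : F 2 1 = F (-1) (-2) - 3 * F 0 (-1) + 3 * F 1 0 by exact: (FE (-1) (-2) 1 1).
have d2 : F 2 (-1) = F (-1) 2 - 3 * F 0 1 + 3 * F 1 0 by exact: (FE (-1) 2 1 (-1)).
have d3 : F 2 (-2) = F (-1) 1 - 3 * F 0 0 + 3 * F 1 (-1) by exact: (FE (-1) 1 1 (-1)).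
have : F 1 1 + F 1 (-1) - 2 * F 1 0 = F 0 1 + F 0 (-1) - 2 * F 0 0.
  clear FE; lra.
by rewrite /F !(mulr0z, mulrNz, mulr1z, scale0r, scale1r, scaleNr, add0r, addr0).
Qed.

Definition hess_form u w : R :=
  d (translate O (u + w)) - d (translate O u) - d (translate O w) + d O.

Let hess_formE u w : hess_form u w = f (u + w) - f u - f w + f 0.
Proof. by rewrite /hess_form /f translate0. Qed.

Let hess_formC u w : hess_form u w = hess_form w u.
Proof. by rewrite !hess_formE (addrC u w); ring. Qed.

Let half2 u : 2^-1 *: u + 2^-1 *: u = u.
Proof.
rewrite -scalerDl (_ : 2^-1 + 2^-1 = 1) ?scale1r //; by field.
Qed.

Let hess_formD u v w : hess_form (u + v) w = hess_form u w + hess_form v w.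
Proof.
set m := 2^-1 *: (u + v); set k := 2^-1 *: (u - v).
have mm : m + m = u + v by exact: half2.
have mk : m + k = u by rewrite -scalerDr addrACA subrr addr0 scalerDr half2.
have mk' : m - k = v.
  by rewrite -scalerBr opprB [v - u]addrC addrACA subrr add0r scalerDr half2.
have h1 := f_second_diff (w + m) m.
have h2 := f_second_diff (w + m) k.
have h3 := f_second_diff m m.
have h4 := f_second_diff m k.
rewrite -!addrA mm subrr addr0 ![w + _]addrC in h1.
rewrite -!addrA mk mk' ![w + _]addrC in h2.
rewrite mm subrr in h3; rewrite mk mk' in h4.
rewrite !hess_formE; lra.
Qed.

Let hess_formZ b u w : hess_form (b *: u) w = b * hess_form u w.
Proof.
have hh : hess_form u w = 2 * hess_form (2^-1 *: u) w.
  by rewrite -{1}(half2 u) hess_formD; ring.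
have := f_line w u b; have := f_line 0 u b.
move: hh; rewrite !hess_formE !add0r ![w + _]addrC => hh -> ->.
have -> : f (2^-1 *: u + w) = (f (u + w) - f u - f w + f 0) / 2
                              + f (2^-1 *: u) + f w - f 0.
  by rewrite hh; field.
by field.
Qed.

Let hess_form_bilinear :
  bilinear_for (GRing.Scale.Law.clone _ _ *%R _)
    (GRing.Scale.Law.clone _ _ (@idfun R \; *%R) _) hess_form.
Proof.
split=> [w|w] b u v /=.
  by rewrite hess_formD hess_formZ.
by rewrite !(hess_formC w) hess_formD hess_formZ.
Qed.

Let hess_form_hermitian u w : hess_form u w = (-1) ^+ false * idfun (hess_form w u).
Proof. by rewrite expr0 mul1r hess_formC. Qed.

#[local]
HB.instance Definition _ := bilinear_isBilinear.Build R V V R _ _ hess_form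
  hess_form_bilinear.
#[local]
HB.instance Definition _ := isHermitianSesquilinear.Build R V false idfun hess_form
  hess_form_hermitian.

Lemma hessian_exists_at : exists g, is_hessian d g.
Proof.
exists hess_form => P Q; rewrite /reflection /acomb scaleN1r.
set u := vec O P; set w := vec P Q.
have -> : d (translate P (- w)) = f (u - w).
  by rewrite /f -translateD translate_vec.
have -> : d Q = f (u + w) by rewrite /f -translateD !translate_vec.
have -> : d P = f u by rewrite /f translate_vec.
have h1 := f_second_diff u w; have h2 := f_second_diff w w.
rewrite subrr in h2; rewrite /= hess_formE; lra.
Qed.

End HessianExistence.

Lemma hessian_exists d : is_quadratic d -> exists g, is_hessian d g.
Proof.
move=> dq; case: (affine_inhabited : inhabited A) => O.
exact: hessian_exists_at dq O.
Qed.

Lemma hessian_unique d g h : is_hessian d g -> is_hessian d h -> g =2 h.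
Proof.
case: (affine_inhabited : inhabited A) => O dg dh.
have diag u : g u u = h u u.
  have := dg O (translate O u); have := dh O (translate O u).
  by rewrite vec_translate => -> /(mulfI _) ->; rewrite ?invr_eq0 ?pnatr_eq0.
have polar (k : {symmetric V}) u v : 2 * k u v = k (u + v) (u + v) - k u u - k v v.
  have kC : k v u = k u v by rewrite hermC expr0 mul1r.
  rewrite linearDl !linearDr /= kC; ring.
move=> u v; apply: (@mulfI _ 2); rewrite ?pnatr_eq0 //.
by rewrite !polar !diag.
Qed.

Lemma hessian_Aff (d e : Quad) g :
  \pi_Met d = \pi_Met e -> is_hessian d g -> is_hessian e g.
Proof.
move=> /eqP; rewrite -Quotient.idealrBE => /asboolP de dg P Q.
have ab : 2 + - 1 = 1 :> R by ring.
have h2 : d (reflection P Q) - e (reflection P Q)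
          = 2 * (d P - e P) + (- 1) * (d Q - e Q) := de P Q 2 (- 1) ab.
have h1 := dg P Q; rewrite /= in h1 h2 *; lra.
Qed.

Lemma quad_hessian (d : Quad) : exists g, is_hessian d g.
Proof. by case: d => d /= /asboolP /hessian_exists. Qed.

Definition Hess (d : Quad) : {symmetric V} := projT1 (cid (quad_hessian d)).

Lemma HessP (d : Quad) : is_hessian d (Hess d).
Proof. by rewrite /Hess; case: cid. Qed.

(* Computed on a representative; independent of the choice by met_hessE. *)
Definition met_hess (m : Met) : {symmetric V} := Hess (repr m).

Lemma met_hessE (d : Quad) : met_hess (\pi_Met d) =2 Hess d.
Proof.
apply: (@hessian_unique d); last exact: HessP.
by apply: hessian_Aff (HessP _); rewrite reprK.
Qed.

Definition radical (m : Met) : {vspace V} := orthov (met_hess m) fullv.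

Lemma radicalP (m : Met) u :
  reflect (forall v, met_hess m u v = 0) (u \in radical m).
Proof.
apply: (iffP mem_orthovP) => [h v|h v _]; last exact: h.
by apply: h; rewrite memvf.
Qed.

Definition met_nondegenerate (m : Met) : bool := radical m == 0%VS.

Definition sqdist_mx (m : Met) n (r : 'I_n.+1 -> A) : 'M[R]_n.+1 :=
  \matrix_(i, j) met_hess m (vec (r i) (r j)) (vec (r i) (r j)).

Definition cayley_menger_mx (m : Met) n (r : 'I_n.+1 -> A) : 'M[R]_(n.+1 + 1) :=
  block_mx (sqdist_mx m r) (const_mx 1)
           (const_mx 1)    0.

Lemma vecxx P : vec P P = 0.
Proof. by rewrite -{2}(translate0 P) vec_translate. Qed.

Lemma vecC P Q : vec Q P = - vec P Q.
Proof.
have {1}-> : P = translate Q (- vec P Q).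
  by rewrite -{1}(translate_vec P Q) translateD subrr translate0.
exact: vec_translate.
Qed.

Lemma cayley_menger_mx_hollow m n (r : 'I_n.+1 -> A) i :
  cayley_menger_mx m r i i = 0.
Proof.
rewrite -[i]fintype.splitK; case: (fintype.split i) => j /=; rewrite /cayley_menger_mx.
  by rewrite block_mxEul mxE vecxx linear0l.
by rewrite block_mxEdr mxE.
Qed.

Lemma cayley_menger_mx_sym m n (r : 'I_n.+1 -> A) :
  (cayley_menger_mx m r)^T = cayley_menger_mx m r.
Proof.
rewrite tr_block_mx trmx0 !trmx_const; congr block_mx.
by apply/matrixP => i j; rewrite !mxE (vecC (r i)) linearNl linearNr opprK.
Qed.

End Affine.

(* Main.v *)
Require Import Defs.
From mathcomp Require Import all_boot all_order all_algebra.
From mathcomp Require Import reals sesquilinear.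
From mathcomp Require Import ring.

(** The kernel of the bordered matrix is a copy of the radical of the metric.

    Put [e_i = vec (r 0) (r i)], so that [e_0 = 0], and let [(x, t)] be a row
    vector of size [(n+1) + 1].  By polarization
    [D_ij = g(e_i, e_i) - 2 g(e_i, e_j) + g(e_j, e_j)], so when the weights
    [x_i] sum to [0], which is what the last column of the matrix imposes, the
    contribution of [g(e_j, e_j)] cancels and column [j] of [(x, t)] times the
    matrix is [c + t - 2 g(w, e_j)], where [w = \sum x_i e_i] and
    [c = \sum x_i g(e_i, e_i)].  At [j = 0] this reads [c + t = 0], which fixes
    [t], and the other columns then say that [w] is orthogonal to every [e_j]
    ([cayley_menger_kernelP]).  Since the [e_j] with [j > 0] form a basis, this
    means that [w] is in the radical ([radical_edgeP]); for the same reason each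
    vector [w] is [\sum x_i e_i] for exactly one family of weights of sum [0]
    ([edge_weights_exist] and [edge_weights_unique]).  Hence [(x, t) |-> w]
    identifies the kernel with the radical, and one is trivial exactly when the
    other is. *)

Set Implicit Arguments.
Unset Strict Implicit.
Unset Printing Implicit Defensive.

Import Order.TTheory GRing.Theory Num.Theory.
Local Open Scope ring_scope.

Section CayleyMenger.
Variables (R : realType) (V : vectType R) (A : affineType V).
Implicit Types (m : Met A) (u v w : V).

Lemma vec_chasles (P Q S : A) : vec Q S = vec P S - vec P Q.
Proof.
have {1}-> : S = translate Q (vec P S - vec P Q).
  by rewrite -{1}(translate_vec P Q) translateD addrC subrK translate_vec.
exact: vec_translate.
Qed.

Lemma symmetric_formC (g : {symmetric V}) u v : g v u = g u v.
Proof. by rewrite hermC expr0 mul1r. Qed.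

Lemma symmetric_form_subr (g : {symmetric V}) u v :
  g (u - v) (u - v) = g u u - 2 * g u v + g v v.
Proof.
rewrite linearBl !linearBr /= (symmetric_formC g u v); ring.
Qed.

Section Referential.
Variables (n : nat) (r : 'I_n.+1 -> A).
Implicit Types (x : 'rV[R]_n.+1).

Definition edge (i : 'I_n.+1) : V := vec (r ord0) (r i).

Definition edge_sum x : V := \sum_i x 0 i *: edge i.

Lemma edge0 : edge ord0 = 0.
Proof. exact: vecxx. Qed.

Lemma edge_sum_lift x :
  edge_sum x = \sum_(i < n) x 0 (lift ord0 i) *: edge (lift ord0 i).
Proof. by rewrite /edge_sum big_ord_recl edge0 scaler0 add0r. Qed.

Section Basis.
Hypothesis hr : affine_referential r.

Let basis_edges := [tuple edge (lift ord0 i) | i < n].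

Let basis_edges_free : free basis_edges.
Proof. by case: hr. Qed.

Let basis_edges_span w : w \in <<basis_edges>>%VS.
Proof.
suff /eqP -> : (<<basis_edges>> == fullv)%VS by exact: memvf.
rewrite eqEdim subvf /= (eqP basis_edges_free) size_tuple.
by case: hr => dimV _; exact: eq_leq (esym dimV).
Qed.

Lemma edge_weights_unique x :
  \sum_i x 0 i = 0 -> edge_sum x = 0 -> x = 0.
Proof.
rewrite edge_sum_lift => sumx wx.
have xl i : x 0 (lift ord0 i) = 0.
  move/freeP/(_ (fun k => x 0 (lift ord0 k))): basis_edges_free.
  apply; rewrite -[RHS]wx.
  by apply: eq_bigr => k _; rewrite -tnth_nth tnth_mktuple.
apply/rowP => i; rewrite mxE; case: (unliftP ord0 i) => [k ->|->]; first exact: xl.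
by rewrite -[RHS]sumx big_ord_recl big1 ?addr0.
Qed.

Lemma edge_weights_exist w :
  exists2 x : 'rV[R]_n.+1, \sum_i x 0 i = 0 & edge_sum x = w.
Proof.
pose c i := coord basis_edges i w.
(* The weight of [r 0], whose edge vanishes, is free to make the sum zero. *)
pose x : 'rV[R]_n.+1 :=
  \row_i if unlift ord0 i is Some k then c k else - \sum_k c k.
have x0 : x 0 ord0 = - \sum_k c k by rewrite mxE unlift_none.
have xl k : x 0 (lift ord0 k) = c k by rewrite mxE liftK.
exists x; first by rewrite big_ord_recl x0 (eq_bigr _ (fun k _ => xl k)) addNr.
rewrite edge_sum_lift [RHS](coord_span (basis_edges_span w)).
by apply: eq_bigr => i _; rewrite xl -tnth_nth tnth_mktuple.
Qed.

Lemma radical_edgeP m w :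
  (forall j, met_hess m w (edge j) = 0) <-> w \in radical m.
Proof.
split=> [h|/radicalP h j]; last exact: h.
apply/radicalP => v; have [x _ <-] := edge_weights_exist v.
by rewrite linear_sumr big1 // => i _; rewrite linearZr /= h mulr0.
Qed.

End Basis.

Lemma sqdist_mxE m i j :
  sqdist_mx m r i j = met_hess m (edge i) (edge i)
    - 2 * met_hess m (edge i) (edge j) + met_hess m (edge j) (edge j).
Proof.
rewrite mxE (vec_chasles (r ord0)) symmetric_form_subr.
rewrite (symmetric_formC _ (edge i) (edge j)); ring.
Qed.

Definition edge_moment m x : R := \sum_i x 0 i * met_hess m (edge i) (edge i).

Lemma mul_sqdist_mx m x j : \sum_i x 0 i = 0 ->
  (x *m sqdist_mx m r) 0 j
    = edge_moment m x - 2 * met_hess m (edge_sum x) (edge j).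
Proof.
move=> sumx; pose g := met_hess m; rewrite mxE.
have -> : \sum_k x 0 k * sqdist_mx m r k j =
    \sum_k x 0 k * g (edge k) (edge k) - 2 * (\sum_k x 0 k * g (edge k) (edge j))
    + (\sum_k x 0 k) * g (edge j) (edge j).
  rewrite mulr_sumr mulr_suml -sumrB -big_split /=.
  by apply: eq_bigr => k _; rewrite sqdist_mxE /g; ring.
rewrite sumx mul0r addr0 /edge_sum linear_sumlz; congr (_ - 2 * _).
by apply: eq_bigr => k _; rewrite linearZl.
Qed.

(** Column [0] pins down the last coordinate because [edge ord0 = 0]; the
    remaining columns are then left with the orthogonality conditions. *)
Lemma cayley_menger_kernelP m x (t : 'M[R]_1) :
  row_mx x t *m cayley_menger_mx m r = 0 <->
  [/\ \sum_i x 0 i = 0, edge_moment m x + t 0 0 = 0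
    & forall j, met_hess m (edge_sum x) (edge j) = 0].
Proof.
have topE j : (x *m sqdist_mx m r + t *m const_mx 1) 0 j
              = (x *m sqdist_mx m r) 0 j + t 0 0.
  by rewrite mxE; congr (_ + _); rewrite mxE big_ord1 mxE mulr1.
have sumE : (x *m const_mx 1 + t *m 0 : 'M[R]_1) 0 0 = \sum_i x 0 i.
  rewrite mulmx0 addr0 mxE.
  by apply: eq_bigr => i _; rewrite mxE mulr1.
rewrite /cayley_menger_mx mul_row_block; split.
  rewrite -[X in _ = X]row_mx0 => /eq_row_mx[top bot].
  have sumx : \sum_i x 0 i = 0 by rewrite -sumE bot mxE.
  have col j : edge_moment m x - 2 * met_hess m (edge_sum x) (edge j) + t 0 0 = 0.
    by rewrite -mul_sqdist_mx // -topE top mxE.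
  have ct : edge_moment m x + t 0 0 = 0.
    by have := col ord0; rewrite edge0 linear0r mulr0 subr0.
  split=> // j; have := col j; rewrite addrAC ct add0r => /eqP.
  by rewrite oppr_eq0 mulf_eq0 pnatr_eq0 /= => /eqP.
case=> sumx ct orth; rewrite -[RHS]row_mx0; congr row_mx.
  by apply/rowP => j; rewrite topE mul_sqdist_mx // orth mulr0 subr0 ct mxE.
by apply/rowP => j; rewrite ord1 sumE sumx mxE.
Qed.

End Referential.
End CayleyMenger.

Theorem proposition4p7 (R : realType) (V : vectType R) (A : affineType V)
    (n : nat) (r : 'I_n.+1 -> A) (hr : affine_referential r) (m : Met A) :
  met_nondegenerate m <-> cayley_menger_mx m r \in unitmx.
Proof.
rewrite -row_free_unit; split=> [/eqP rad0 | cm_free].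
  apply: inj_row_free => y; rewrite -[y]hsubmxK.
  case/cayley_menger_kernelP=> sumx ct /(radical_edgeP hr).
  rewrite rad0 memv0 => /eqP /(edge_weights_unique hr sumx) x0.
  move: ct; rewrite x0 /edge_moment big1 ?add0r => [t0|i _]; last by rewrite mxE mul0r.
  by rewrite [rsubmx y]mx11_scalar t0 raddf0 row_mx0.
apply/eqP/vspaceP => w; rewrite memv0; apply/idP/eqP => [|->]; last exact: mem0v.
have [x sumx <-] := edge_weights_exist hr w.
move/(radical_edgeP hr) => orth.
have ker : row_mx x (- edge_moment r m x)%:M *m cayley_menger_mx m r = 0.
  by apply/cayley_menger_kernelP; split=> //; rewrite mxE mulr1n subrr.
have := row_free_inj cm_free (etrans ker (esym (mul0mx _ _))).
rewrite -[X in _ = X]row_mx0 => /eq_row_mx[-> _].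
by rewrite /edge_sum big1 // => i _; rewrite mxE scale0r.
Qed.
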